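(* Let $\alpha,\beta,c\in\mathbb{R}$ with $\beta<0$ and $c\neq 0$, and let $\{P_m(s)\}_{m=0}^{\infty}$ be the sequence of polynomials generated by $$\sum_{m=0}^{\infty}\frac{P_m(s)}{m!}z^m=e^{czs+\alpha z^2+\beta z^4}\qquad (s,z\in\mathbb{C}).$$ Then for every $m\ge 0$, every complex zero of $P_m$ is either real or purely imaginary.
   Context: The generating relation means that $P_m(s)/m!$ is the coefficient of $z^m$ in the power series expansion in $z$ of $e^{czs+\alpha z^2+\beta z^4}$; each $P_m$ is a polynomial in $s$. *)

(* Defs.v *)
From HB Require Import structures.
From mathcomp Require Export all_boot all_order all_algebra.
From mathcomp Require Export all_classical all_reals.
From mathcomp Require Export topology normedtype sequences exp trigo.
From mathcomp Require Export complex.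
Export Order.TTheory GRing.Theory Num.Theory.
Export numFieldNormedType.Exports.

Set Implicit Arguments.
Unset Strict Implicit.
Unset Printing Implicit Defensive.

Local Open Scope ring_scope.
Local Open Scope complex_scope.
Local Open Scope classical_set_scope.

Definition expC (R : realType) (w : R[i]) : R[i] :=
  let: x +i* y := w in (expR x)%:C * (cos y +i* sin y).

(* R[i] carries no canonical topology; R[i]^o is the same field with the
   topology of its modulus. *)
Definition generated_by_exp (R : realType) (alpha beta c : R)
    (P : nat -> {poly R[i]}) : Prop :=
  forall s z : R[i],
    series (fun m => (P m).[s] / m`!%:R * z ^+ m : R[i]^o) @ \oo -->
    (expC (c%:C * z * s + alpha%:C * z ^+ 2 + beta%:C * z ^+ 4) : R[i]^o).

(* Main.v *)
(** Put t = c s.  The coefficient of z^m in e^{tz} e^{alpha z^2 + beta z^4} is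
    sum_j h_j t^(m - 2j) / (m - 2j)!, where h_j = [w^j] e^{alpha w + beta w^2}.
    With m = 2n + e, e in {0, 1}, it equals t^e sum_k h_(n-k) (t^2)^k / (2k + e)!.
    Now G_n(u) = sum_k h_(n-k) u^k / k! = [w^n] e^{uw + alpha w + beta w^2} is a
    rescaled Hermite polynomial, real-rooted because beta < 0, and
    k! / (2k + e)! = 4^(-k) / (1/2 + e)_k is Laguerre's multiplier sequence, which
    preserves real-rootedness.  Hence t^2 is real whenever t is a zero.

    Real-rootedness is propagated through the fact that f'(s)/f(s) and s lie in
    opposite half planes when f has only real zeros. *)
Require Import Defs.
From mathcomp Require Import derive realfun.
From mathcomp Require Import ring.

Set Implicit Arguments.
Unset Strict Implicit.
Unset Printing Implicit Defensive.

Local Open Scope ring_scope.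

(** * Real-rooted polynomials and operators that preserve them *)

Section RealRooted.
Variable C : numClosedFieldType.
Implicit Types (f : {poly C}) (a s z : C).

Definition real_rooted f := forall z, root f z -> z \is Num.real.

Lemma real_rooted_neq0 f : real_rooted f -> f != 0.
Proof.
move=> fR; apply/eqP => f0; have := fR 'i; rewrite f0 root0 => /(_ isT)/Creal_ImP.
by rewrite Im_i => /eqP; rewrite oner_eq0.
Qed.

Lemma real_rooted_factor f : real_rooted f ->
  exists2 r : seq C, all (mem Num.real) r &
    f = lead_coef f *: \prod_(z <- r) ('X - z%:P).
Proof.
move=> fR; have f0 := real_rooted_neq0 fR.
have [r fE] := closed_field_poly_normal f; exists r => //.
apply/allP => z zr; apply: fR.
by rewrite fE rootZ ?lead_coef_eq0// root_prod_XsubC.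
Qed.

Lemma Im_subr_real s z : z \is Num.real -> 'Im (s - z) = 'Im s.
Proof. by move=> /Creal_ImP zR; rewrite raddfB /= zR subr0. Qed.

Lemma subr_real_neq0 s z : 'Im s != 0 -> z \is Num.real -> s - z != 0.
Proof.
by move=> s0 zR; apply: contraNneq s0 => sz; rewrite -(Im_subr_real s zR) sz raddf0.
Qed.

(* Each summand 1 / (s - z) of f' / f lies in the half plane opposite to s. *)
Lemma Im_logderiv_prod (r : seq C) s : all (mem Num.real) r -> 'Im s != 0 ->
  let p := \prod_(z <- r) ('X - z%:P) in
  p.[s] != 0 /\ 'Im (p^`().[s] / p.[s]) * 'Im s <= 0.
Proof.
move=> + s0; elim: r => [_|z r IH] /=.
  by rewrite big_nil hornerC oner_neq0 derivC horner0 mul0r raddf0 mul0r.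
move=> /andP[zR /IH [q0 qs]]; rewrite big_cons.
set q := \prod_(_ <- _) _ in q0 qs *.
have sz := subr_real_neq0 s0 zR.
rewrite derivM derivXsubC mul1r hornerD !hornerM hornerXsubC mulf_neq0//; split=> //.
have -> : (q.[s] + (s - z) * q^`().[s]) / ((s - z) * q.[s]) =
    (s - z)^-1 + q^`().[s] / q.[s] by field; rewrite q0.
rewrite raddfD /= mulrDl -[0]addr0 lerD// ImV Im_subr_real//.
rewrite mulrAC mulNr -expr2 mulNr oppr_le0 divr_ge0//; last by rewrite exprn_ge0.
by rewrite -realEsqr Creal_Im.
Qed.

Lemma Im_logderiv f s : real_rooted f -> 'Im s != 0 ->
  f.[s] != 0 /\ 'Im (f^`().[s] / f.[s]) * 'Im s <= 0.
Proof.
move=> fR s0; have [r rR fE] := real_rooted_factor fR.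
have [p0 ps] := Im_logderiv_prod rR s0.
have l0 : lead_coef f != 0 by rewrite lead_coef_eq0 real_rooted_neq0.
rewrite fE derivZ !hornerZ mulf_neq0//; split => //.
by rewrite -mulf_div divff// mul1r.
Qed.

Lemma Im_sqr_gt0 s : 'Im s != 0 -> 0 < 'Im s ^+ 2.
Proof. by move=> s0; rewrite lt0r expf_neq0//= -realEsqr Creal_Im. Qed.

(** At a non-real zero s, division by f(s) gives s + a + b f'(s)/f(s) = 0. As b < 0, the imaginary
    part of b f'(s)/f(s) has weakly the sign of that of s, so the two cannot cancel. *)
Lemma real_rooted_hermite_step f a b : real_rooted f -> a \is Num.real -> b < 0 ->
  real_rooted (('X + a%:P) * f + b *: f^`()).
Proof.
move=> fR aR b0 s; rewrite /root hornerD hornerM hornerD hornerX hornerC hornerZ.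
move=> /eqP s0; apply/Creal_ImP/eqP; apply/negPn/negP => Is.
have [fs fI] := Im_logderiv fR Is.
have : s + a + b * (f^`().[s] / f.[s]) = 0.
  by apply: (mulIf fs); rewrite mul0r -s0; field.
move=> /(congr1 (fun z => 'Im z * 'Im s)); rewrite raddf0 mul0r !raddfD /=.
rewrite (Creal_ImP _ aR) addr0 ImMl ?ltr0_real// mulrDl -expr2 -mulrA => /eqP.
by rewrite gt_eqF// ltr_pwDl ?Im_sqr_gt0// nmulr_rge0.
Qed.

(** At a non-real zero s, division by s f(s) gives f'(s)/f(s) + a/s = 0. Both terms lie in the half
    plane opposite to s, the second strictly. *)
Lemma real_rooted_euler_step f a : real_rooted f -> 0 < a ->
  real_rooted ('X * f^`() + a *: f).
Proof.
move=> fR a0 s; rewrite /root hornerD hornerM hornerX hornerZ.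
move=> /eqP s0; apply/Creal_ImP/eqP; apply/negPn/negP => Is.
have [fs fI] := Im_logderiv fR Is.
have sn0 : s != 0 by apply: contraNneq Is => ->; rewrite raddf0.
have : f^`().[s] / f.[s] + a * s^-1 = 0.
  by apply: (mulIf fs); apply: (mulfI sn0); rewrite mul0r mulr0 -s0; field; rewrite ?fs ?sn0.
move=> /(congr1 (fun z => 'Im z * 'Im s)); rewrite raddf0 mul0r !raddfD /=.
rewrite ImMl ?gtr0_real// ImV mulrDl => /eqP.
rewrite lt_eqF// -[0]addr0 ler_ltD// -mulrA pmulr_rlt0//.
by rewrite mulrAC mulNr -expr2 mulNr oppr_lt0 divr_gt0 ?Im_sqr_gt0// exprn_gt0// normr_gt0.
Qed.

(** Every root z is real, so each linear factor satisfies |s - z| >= |Im s|. *)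
Lemma norm_horner_ge f s : real_rooted f ->
  `|lead_coef f| * `|'Im s| ^+ (size f).-1 <= `|f.[s]|.
Proof.
move=> fR; have [r rR fE] := real_rooted_factor fR.
have l0 : lead_coef f != 0 by rewrite lead_coef_eq0 real_rooted_neq0.
have -> : (size f).-1 = size r by rewrite {1}fE size_scale// size_prod_XsubC.
rewrite [in leRHS]fE hornerZ normrM.
rewrite ler_wpM2l//; elim: r rR {fE} => [_|z r IH /= /andP[zR /IH rs]].
  by rewrite big_nil hornerC normr1.
rewrite big_cons hornerM normrM hornerXsubC exprS ler_pM ?exprn_ge0//.
rewrite -(Im_subr_real s zR) -(ler_pXn2r (ltn0Sn 1)) ?nnegrE//.
by rewrite [leRHS]normC2_Re_Im real_normK ?Creal_Im// lerDr -realEsqr Creal_Re.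
Qed.

(** The Pochhammer symbol (a)_k. *)
Definition rising a k := \prod_(i < k) (a + i%:R).

Lemma risingS a k : rising a k.+1 = rising a k * (a + k%:R).
Proof. by rewrite /rising big_ord_recr. Qed.

Lemma rising_gt0 a k : 0 < a -> 0 < rising a k.
Proof. by move=> a0; apply: prodr_gt0 => i _; rewrite ltr_wpDr. Qed.

Lemma risingD a m k : rising a (m + k) = rising a m * rising (a + m%:R) k.
Proof.
by rewrite /rising big_split_ord; congr (_ * _); apply: eq_bigr => i _;
  rewrite natrD addrA.
Qed.

(** The operator X d/dX + (a + i) multiplies the coefficient of X^k by a + k + i; composing over i <
    M yields the factor (a + k)_M. *)
Lemma real_rooted_euler_iter f a M : real_rooted f -> 0 < a ->
  exists2 g, real_rooted g & forall k, g`_k = rising (a + k%:R) M * f`_k.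
Proof.
move=> fR a0; elim: M => [|M [g gR gE]].
  by exists f => // k; rewrite /rising big_ord0 mul1r.
exists ('X * g^`() + (a + M%:R) *: g).
  by apply: real_rooted_euler_step => //; rewrite ltr_wpDr.
move=> k; rewrite coefD coefZ coefXM coef_deriv risingS.
by case: k => [|k] /=; rewrite !gE// -mulr_natr; ring.
Qed.

Lemma rising_ratio_ge1 a M k : 0 < a -> (0 < M)%N ->
  1 <= rising (a + M%:R) k / M%:R ^+ k.
Proof.
move=> a0 M0; elim: k => [|k IH]; first by rewrite /rising big_ord0 divr1.
have M0' : 0 < M%:R :> C by rewrite ltr0n.
rewrite risingS exprSr -mulf_div; apply: mulr_ege1 => //.
by rewrite ler_pdivlMr// mul1r -addrA addrCA lerDl addr_ge0// ltW.
Qed.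

(** The ratio is the product of the 1 + (a + i)/M, a convex function of 1/M on [0, 1]. The bound is
    its chord between 1/M = 0 and 1/M = 1, where the values are 1 and (a + 1)_k. *)
Lemma rising_ratio_le a M k : 0 < a -> (0 < M)%N ->
  rising (a + M%:R) k / M%:R ^+ k <= 1 + (rising (a + 1) k - 1) / M%:R.
Proof.
move=> a0 M0; elim: k => [|k IH].
  by rewrite /rising !big_ord0 divr1 subrr mul0r addr0.
have M0' : 0 < M%:R :> C by rewrite ltr0n.
have Mn0 := lt0r_neq0 M0'.
have ak0 : 0 < a + k%:R by rewrite ltr_wpDr.
have W1 : 0 <= rising (a + 1) k - 1.
  by have := @rising_ratio_ge1 a 1 k a0 isT; rewrite expr1n divr1 subr_ge0.
rewrite risingS exprSr -mulf_div.
have -> : (a + M%:R + k%:R) / M%:R = 1 + (a + k%:R) / M%:R by field.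
apply: le_trans (ler_wpM2r _ IH) _; first by rewrite addr_ge0// divr_ge0// ltW.
rewrite risingS; set W := rising _ _ in W1 *; set x := a + k%:R in ak0 *.
have -> : a + 1 + k%:R = 1 + x by rewrite /x; ring.
rewrite -subr_ge0.
have -> : 1 + (W * (1 + x) - 1) / M%:R - (1 + (W - 1) / M%:R) * (1 + x / M%:R) =
  ((W - 1) * x) * (M%:R^-1 * (1 - M%:R^-1)) by field.
apply: mulr_ge0; first by rewrite mulr_ge0// ltW.
by rewrite mulr_ge0// ?subr_ge0 ?invr_ge0 ?(ltW M0')// invf_le1// ler1n.
Qed.

(* Laguerre's multiplier sequence 1 / (a)_k: with w_k = (a + M)_k / M^k the
   polynomial sum_k f_k / (a)_k * w_k * X^k is, up to scaling, obtained from f by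
   M operators X d/dX + (a + i), and w_k tends to 1 as M grows.  The lower bound
   norm_horner_ge is uniform in M, so it survives in the limit. *)
Lemma real_rooted_inv_rising f a N : Num.archimedean_axiom C ->
  real_rooted f -> 0 < a -> (size f <= N)%N ->
  real_rooted (\poly_(k < N) (f`_k / rising a k)).
Proof.
move=> archi fR a0 fN s; rewrite /root => gs0; apply/Creal_ImP/eqP/negPn/negP => Is.
have f0 := real_rooted_neq0 fR.
pose n := (size f).-1; have sf : size f = n.+1 by rewrite /n polySpred.
pose d k := f`_k / rising a k.
have ds : \sum_(k < n.+1) d k * s ^+ k = 0.
  move: (fN); rewrite sf => nN.
  rewrite -[RHS](eqP gs0) horner_poly (big_ord_widen _ (fun k => d k * s ^+ k) nN).
  rewrite big_mkcond /=; apply: eq_bigr => i _.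
  by case: ltnP => // ni; rewrite /d nth_default ?sf// !mul0r.
(* A non-real zero s will force the positive constant E to be at most K / M for every M, where K / M
   bounds the effect of replacing the weights w_k by 1. *)
pose E := `|d n| * `|'Im s| ^+ n.
have ra k : rising a k != 0 by rewrite gt_eqF// rising_gt0.
have E0 : 0 < E.
  rewrite mulr_gt0// ?exprn_gt0 ?normr_gt0// mulf_neq0 ?invr_eq0//.
  by rewrite /n -lead_coefE lead_coef_eq0.
pose K := \sum_(k < n.+1) `|d k * s ^+ k| * (rising (a + 1) k - 1).
have key M : (0 < M)%N -> E <= K / M%:R.
  move=> M0; have M0' : 0 < M%:R :> C by rewrite ltr0n.
  have Mn0 := lt0r_neq0 M0'.
  have [g gR gE] := real_rooted_euler_iter M fR a0.
  pose w k := rising (a + M%:R) k / M%:R ^+ k.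
  have gkE k : g`_k / M%:R ^+ k = rising a M * (d k * w k).
    (* Both sides equal (a)_(k + M); this trades the factor depending on k and M for one that tends
       to 1 after scaling. *)
    have : rising a k * rising (a + k%:R) M = rising a M * rising (a + M%:R) k.
      by rewrite -!risingD addnC.
    move=> /(canRL (mulKf (ra k))); rewrite gE /d /w => ->.
    by field; rewrite ra expf_neq0.
  have gn : g`_n != 0.
    rewrite gE mulf_neq0//; last by rewrite /n -lead_coefE lead_coef_eq0.
    by rewrite gt_eqF// rising_gt0// ltr_wpDr.
  have sg : size g = n.+1.
    apply/eqP; rewrite eqn_leq; apply/andP; split; last first.
      by rewrite ltnNge; apply: contra gn => sgn; rewrite nth_default.
    by apply/leq_sizeP => j nj; rewrite gE nth_default ?mulr0 ?sf.
  (* Subtracting the vanishing sum of the d_k s^k replaces w_k by w_k - 1, which is O(1/M). *)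
  have gsE : g.[s / M%:R] = rising a M * \sum_(k < n.+1) d k * s ^+ k * (w k - 1).
    rewrite horner_coef sg.
    transitivity (rising a M * \sum_(k < n.+1) d k * s ^+ k * w k).
      rewrite mulr_sumr; apply: eq_bigr => k _.
      by rewrite exprMn exprVn mulrCA gkE; ring.
    congr (_ * _); rewrite -[LHS]subr0 -[X in _ - X]ds -sumrB.
    by apply: eq_bigr => k _; ring.
  have := norm_horner_ge (s / M%:R) gR.
  rewrite gsE lead_coefE sg /= normrM ImMr ?realV ?realn// normrM exprMn normfV.
  rewrite (@ger0_norm _ M%:R)// exprVn [leLHS]mulrA [leLHS]mulrAC => h1.
  have h2 : `|g`_n| / M%:R ^+ n = `|rising a M| * (`|d n| * w n).
    rewrite -[M%:R ^+ n]ger0_norm ?exprn_ge0 ?ltW// -normfV -normrM gkE.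
    rewrite [LHS]normrM [`|d n * w n|]normrM; congr (_ * (_ * _)).
    by apply: ger0_norm; rewrite (le_trans ler01)// rising_ratio_ge1.
  move: h1; rewrite h2 -[leLHS]mulrA ler_pM2l ?normr_gt0// => h1.
  (* Since w_n >= 1, dropping it leaves a lower bound independent of M. *)
  apply: (@le_trans _ _ (`|d n| * (w n * `|'Im s| ^+ n))).
    by rewrite ler_wpM2l// ler_peMl ?exprn_ge0// rising_ratio_ge1.
  rewrite mulrA; apply: le_trans h1 _.
  apply: le_trans (ler_norm_sum _ _ _) _.
  rewrite /K mulr_suml; apply: ler_sum => k _.
  rewrite normrM -mulrA ler_wpM2l// ger0_norm ?subr_ge0 ?rising_ratio_ge1//.
  by rewrite lerBlDl rising_ratio_le.
(* Any M > K / E contradicts E <= K / M. *)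
have [M KM] := archi (K / E).
have K0 : 0 <= K by rewrite -[K]divr1 (le_trans (ltW E0))// (key 1%N).
have M0 : (0 < M)%N by rewrite -(ltr0n C) (le_lt_trans _ KM).
have := key M M0; rewrite ler_pdivlMr ?ltr0n// mulrC -ler_pdivlMr// => MK.
move: KM; rewrite ger0_norm ?divr_ge0 ?(ltW E0)// => /(le_lt_trans MK).
by rewrite ltxx.
Qed.

End RealRooted.

(** * Power series operations on coefficient sequences *)

Section ShiftConvolution.
Variable C : comNzRingType.
Implicit Types (d e t : nat -> C).

(** Multiplication of the generating series by its variable. *)
Definition shift d n := if n is n'.+1 then d n' else 0.

Definition conv e t m := \sum_(j < m.+1) e j * t (m - j)%N.

Lemma conv_shift e t m : conv (shift e) t m = shift (conv e t) m.
Proof.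
case: m => [|m]; first by rewrite /conv big_ord1 mul0r.
by rewrite /conv big_ord_recl mul0r add0r.
Qed.

(** The product rule (ET)' = ET' + E'T on coefficients; it comes from splitting the weight m + 1 as
    (m + 1 - j) + j. *)
Lemma conv_deriv e t t' m : (forall j, j.+1%:R * t j.+1 = t' j) ->
  m.+1%:R * conv e t m.+1 =
  conv e t' m + conv (fun j => j.+1%:R * e j.+1) t m.
Proof.
move=> tE; rewrite /conv mulr_sumr.
transitivity (\sum_(j < m.+2) (e j * ((m.+1 - j)%:R * t (m.+1 - j)%N)) +
              \sum_(j < m.+2) (j%:R * e j * t (m.+1 - j)%N)).
  rewrite -big_split; apply: eq_bigr => j _ /=.
  have -> : m.+1%:R = (m.+1 - j)%:R + j%:R :> C by rewrite -natrD subnK// -ltnS.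
  ring.
congr (_ + _).
  rewrite big_ord_recr /= subnn mul0r mulr0 addr0; apply: eq_bigr => j _.
  by rewrite subSn ?tE//; rewrite -ltnS.
by rewrite big_ord_recl /= !mul0r add0r; apply: eq_bigr.
Qed.

(** The coefficients of D(z^2), where D is the generating series of [d]. *)
Definition spread d j := if odd j then 0 else d j./2.

Lemma sum_spread d (F : nat -> C) n :
  \sum_(j < n.*2) spread d j * F j = \sum_(j < n) d j * F j.*2.
Proof.
elim: n => [|n IH]; first by rewrite !big_ord0.
rewrite doubleS !big_ord_recr /= {}IH /spread /= !odd_double /= doubleK.
by rewrite mul0r addr0.
Qed.

End ShiftConvolution.

(** * Hermite polynomials and the coefficients of exp (t z + al z^2 + be z^4) *)

Section HermitePoly.
Variables (C : numClosedFieldType) (al be : C).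

(* hermite n is the coefficient of w^n in exp (X w + al w + be w^2). *)
Fixpoint hermite n : {poly C} :=
  if n is n'.+1 then
    n'.+1%:R^-1 *: (('X + al%:P) * hermite n' + (2 * be) *: (hermite n')^`())
  else 1.

Lemma hermiteS n : n.+1%:R *: hermite n.+1 =
  ('X + al%:P) * hermite n + (2 * be) *: (hermite n)^`().
Proof. by rewrite /= scalerA divff ?scale1r// pnatr_eq0. Qed.

Lemma hermite_real_rooted n : al \is Num.real -> be < 0 -> real_rooted (hermite n).
Proof.
move=> aR b0; elim: n => [|n IH] z /=; first by rewrite (negPf (root1 z)).
rewrite rootZ ?invr_eq0 ?pnatr_eq0//; apply: real_rooted_hermite_step => //.
by rewrite pmulr_rlt0.
Qed.

(** Differentiating exp (X w + al w + be w^2) in X multiplies it by w. The induction differentiates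
    the recurrence [hermiteS], which reproduces itself plus one copy of [hermite n.+1]. *)
Lemma deriv_hermite n : (hermite n.+1)^`() = hermite n.
Proof.
elim: n => [|n IH].
  by rewrite /= invr1 scale1r mulr1 !poly.derivE scaler0 !addr0.
apply: (@scalerI _ _ n.+2%:R); first by rewrite pnatr_eq0.
rewrite -derivZ hermiteS derivD derivM IH derivZ derivD derivX derivC addr0 mul1r.
by rewrite -addrA -hermiteS -[n.+2]add1n natrD scalerDl scale1r.
Qed.

(** The coefficient of w^n in exp (al w + be w^2). *)
Definition hermite0 n := (hermite n)`_0.

Lemma coef_hermite n k :
  (hermite n)`_k = if (k <= n)%N then hermite0 (n - k) / k`!%:R else 0.
Proof.
elim: k n => [n|k IH [|n]].
- by rewrite leq0n subn0 fact0 divr1.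
- by rewrite coef1.
have k0 : k.+1%:R != 0 :> C by rewrite pnatr_eq0.
apply: (mulIf k0); rewrite mulr_natr -coef_deriv deriv_hermite IH ltnS subSS.
case: ifP => _; last by rewrite mul0r.
by rewrite factS natrM; field; rewrite nat1r k0 pnatr_eq0 -lt0n fact_gt0.
Qed.

Lemma size_hermite n : (size (hermite n) <= n.+1)%N.
Proof. by apply/leq_sizeP => j nj; rewrite coef_hermite leqNgt nj. Qed.

Lemma hermite0S n :
  n.+1%:R * hermite0 n.+1 = al * hermite0 n + 2 * be * shift hermite0 n.
Proof.
rewrite /hermite0 -coefZ hermiteS coefD mulrDl coefD coefXM coefCM coefZ add0r.
case: n => [|n] /=; last by rewrite deriv_hermite.
by rewrite derivC coef0.
Qed.

(** The equation E' = (2 al z + 4 be z^3) E for E = exp (al z^2 + be z^4). Both sides vanish for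
    even j, and odd j reduces to [hermite0S]. *)
Lemma spread_hermite0S j : j.+1%:R * spread hermite0 j.+1 =
  2 * al * shift (spread hermite0) j +
  4 * be * shift (shift (shift (spread hermite0))) j.
Proof.
rewrite -[j]odd_double_half; case: (odd j) => /=; last first.
  case: (j./2) => [|[|i]]; rewrite /spread /= ?odd_double /=; ring.
rewrite /spread /= odd_double /= doubleK.
have -> : (j./2).*2.+2%:R = 2 * j./2.+1%:R :> C by rewrite -doubleS -mul2n natrM.
rewrite -[LHS]mulrA add0n hermite0S; case: (j./2) => [|i] /=; first by ring.
by rewrite odd_double /= doubleK; ring.
Qed.

(** Going from k to k + 1 adds two factors with product 4 (k + 1/2 + e) (k + 1), for either parity
    e. This separates the 1 / k! of the Hermite coefficients from Laguerre's multiplier. *)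
Lemma fact_rising (e : bool) k :
  (k.*2 + e)`!%:R = 4 ^+ k * rising (2^-1 + e%:R) k * k`!%:R :> C.
Proof.
elim: k => [|k IH]; first by rewrite /rising big_ord0 expr0 !mul1r; case: e.
rewrite doubleS !addSn !factS !natrM IH risingS exprS.
have -> : (k.*2 + e).+2%:R = 2 * k%:R + e%:R + 2 :> C.
  by rewrite -addn2 !natrD -mul2n natrM.
have -> : (k.*2 + e).+1%:R = 2 * k%:R + e%:R + 1 :> C.
  by rewrite -addn1 !natrD -mul2n natrM.
by rewrite -natr1; case: e {IH} => /=; field.
Qed.

Definition exp_coef (t : C) k := t ^+ k / k`!%:R.

Lemma exp_coefS t k : k.+1%:R * exp_coef t k.+1 = t * exp_coef t k.
Proof.
rewrite /exp_coef factS natrM exprS; field.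
by rewrite nat1r !pnatr_eq0 -lt0n fact_gt0.
Qed.

Lemma conv_spread_hermite (e : bool) n t :
  conv (spread hermite0) (exp_coef t) (n.*2 + e) =
  t ^+ e * (\poly_(k < n.+1) ((hermite n)`_k / rising (2^-1 + e%:R) k)).[t ^+ 2 / 4].
Proof.
transitivity (\sum_(j < n.+1) hermite0 j * exp_coef t (n.*2 + e - j.*2)).
  rewrite -(sum_spread _ (fun j => exp_coef t (n.*2 + e - j)%N)).
  rewrite /conv; case: e; rewrite ?addn1 ?addn0 ?doubleS//.
  (* For e = 0 the doubled range has one extra index, 2n + 1, where [spread] vanishes. *)
  by rewrite [RHS]big_ord_recr /= /spread /= odd_double mul0r addr0.
rewrite (reindex_inj rev_ord_inj) horner_poly mulr_sumr; apply: eq_bigr => k _ /=.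
rewrite subSS; have kn : (k <= n)%N by rewrite -ltnS.
rewrite coef_hermite kn doubleB -addnBAC ?leq_double ?leq_subr//.
rewrite subKn ?leq_double// /exp_coef fact_rising exprD exprMn exprVn -exprM.
rewrite mul2n; field.
have h : 0 < 2^-1 + e%:R :> C by rewrite ltr_wpDr ?invr_gt0.
by rewrite (gt_eqF (rising_gt0 _ h)) expf_neq0 ?pnatr_eq0// -lt0n fact_gt0.
Qed.

(** The recurrence together with [a 0] determines the sequence, and the Cauchy product satisfies it
    by the product rule. The recurrence looks back as far as m - 3, hence the strong induction. *)
Lemma exp_quartic_coef (a : nat -> C) t :
    a 0 = 1 ->
    (forall m, m.+1%:R * a m.+1 =
       t * a m + 2 * al * shift a m + 4 * be * shift (shift (shift a)) m) ->
  a =1 conv (spread hermite0) (exp_coef t).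
Proof.
move=> a0 aS; set b := conv _ _.
have bS m : m.+1%:R * b m.+1 =
       t * b m + 2 * al * shift b m + 4 * be * shift (shift (shift b)) m.
  rewrite /b (conv_deriv _ _ (exp_coefS t)) -addrA; congr (_ + _).
    by rewrite /conv mulr_sumr; apply: eq_bigr => j _; rewrite mulrCA.
  transitivity (2 * al * conv (shift (spread hermite0)) (exp_coef t) m +
    4 * be * conv (shift (shift (shift (spread hermite0)))) (exp_coef t) m).
    rewrite /conv !mulr_sumr -big_split /=; apply: eq_bigr => j _.
    by rewrite spread_hermite0S; ring.
  by do 3 (rewrite ?conv_shift; case: m => [|m] //=).
have b0 : b 0 = 1 by rewrite /b /conv big_ord1 /spread /exp_coef /hermite0 coef1 /= divr1 mulr1.
move=> m; have [n] := ubnP m; elim: n m => // n IH [|m] /ltnSE mn.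
  by rewrite a0 b0.
apply: (@mulfI _ m.+1%:R); first by rewrite pnatr_eq0.
rewrite aS bS IH//.
have sE d d' k : (k <= m)%N -> (forall i, (i < k)%N -> d i = d' i) ->
   @shift C d k = shift d' k.
  by case: k => //= k km; apply.
congr (_ + _ * _ + _ * _); apply: (sE) => // i im.
  by rewrite IH// (ltn_trans im).
apply: (sE) => [|j ji]; first exact: ltnW.
apply: (sE) => [|k kj]; first by rewrite ltnW// (ltn_trans ji).
by rewrite IH// (leq_trans _ mn)// ltnS ltnW// (ltn_trans kj)// (ltn_trans ji).
Qed.

Lemma exp_quartic_coef_zero (a : nat -> C) t m :
    Num.archimedean_axiom C -> al \is Num.real -> be < 0 ->
    a 0 = 1 ->
    (forall m, m.+1%:R * a m.+1 =
       t * a m + 2 * al * shift a m + 4 * be * shift (shift (shift a)) m) ->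
  a m = 0 -> t ^+ 2 \is Num.real.
Proof.
move=> archi aR b0 a0 aS; rewrite (exp_quartic_coef a0 aS).
rewrite -[m]odd_double_half addnC conv_spread_hermite => /eqP.
rewrite mulf_eq0 expf_eq0 => /orP[/andP[_ /eqP ->]|]; first by rewrite expr0n real0.
have h : 0 < 2^-1 + (odd m)%:R :> C by rewrite ltr_wpDr ?invr_gt0.
move=> /(real_rooted_inv_rising archi (@hermite_real_rooted m./2 aR b0) h
  (size_hermite _)) tR.
by rewrite -(divfK (_ : 4 != 0) (t ^+ 2)) ?pnatr_eq0// realM// realn.
Qed.

End HermitePoly.

(** * Real power series converging on the whole line *)

Section EntireSeries.
Local Open Scope classical_set_scope.
Variable R : realType.
Implicit Types (c u v : nat -> R) (f g : R -> R).

(** Convergence at some K > 2|x| bounds the c_n K^n. With n + 1 <= 2^n, the differentiated series is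
    dominated by a geometric series of ratio 2|x| / K < 1. *)
Lemma is_cvg_pseries_diffs c : (forall x, cvgn (pseries c x)) ->
  forall x, cvgn (pseries (pseries_diffs c) x).
Proof.
move=> cc x; have [K K0 xK] : exists2 K : R, 0 < K & 2 * `|x| < K.
  by exists (2 * (`|x| + 1)); rewrite ?ltr_pM2l ?ltrDl// mulr_gt0// ltr_wpDl.
have [M [Mreal Mc]] := cvg_series_bounded (cc K).
have {Mreal}Mc n : `|c n * K ^+ n| <= `|M| + 1.
  by apply: (Mc (`|M| + 1)) => //; rewrite (le_lt_trans (ler_norm _))// ltrDl.
apply: normed_cvg.
apply: (@series_le_cvg _ _ (geometric ((`|M| + 1) / K) (2 * `|x| / K))) => //.
- by move=> n /=.
- by move=> n /=; rewrite !(mulr_ge0, exprn_ge0, invr_ge0, addr_ge0)// (ltW K0).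
- move=> n /=; rewrite /pseries_diffs !normrM normrX normr_nat.
  have nle : n.+1%:R <= 2 ^+ n :> R by rewrite -natrX ler_nat ltn_expl.
  have Kn : K ^+ n.+1 != 0 by rewrite expf_neq0// gt_eqF.
  have h : `|c n.+1| <= (`|M| + 1) / K ^+ n.+1.
    rewrite ler_pdivlMr ?exprn_gt0//; apply: le_trans (Mc n.+1).
    by rewrite normrM ler_wpM2l// ler_norm.
  apply: le_trans (_ : 2 ^+ n * ((`|M| + 1) / K ^+ n.+1) * `|x| ^+ n <= _).
    by rewrite ler_wpM2r ?exprn_ge0// ler_pM.
  rewrite exprSr !exprMn exprVn le_eqVlt; apply/orP; left; apply/eqP.
  by field; rewrite expf_neq0 gt_eqF.
apply: is_cvg_geometric_series.
by rewrite ger0_norm ?divr_ge0 ?mulr_ge0 ?(ltW K0)// ltr_pdivrMr// mul1r.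
Qed.

Lemma is_derive_pseries c f : (forall x, pseries c x @ \oo --> f x) ->
  forall x, is_derive x (1 : R) f (limn (pseries (pseries_diffs c) x)).
Proof.
move=> cf x.
have -> : f = fun x => limn (pseries c x).
  by apply/funext => y; apply/esym/cvg_lim => //; exact: cf.
have c0 y : cvgn (pseries c y) by apply/cvg_ex; exists (f y); exact: cf.
have c1 := is_cvg_pseries_diffs c0.
have c2 := is_cvg_pseries_diffs c1.
apply: (@pseries_snd_diffs _ c (`|x| + 1)) => //.
by rewrite [ltRHS]ger0_norm ?ltrDl// addr_ge0.
Qed.

Lemma cvg_pseries_diffs c f f' : (forall x, pseries c x @ \oo --> f x) ->
  (forall x, is_derive x (1 : R) f (f' x)) ->
  forall x, pseries (pseries_diffs c) x @ \oo --> f' x.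
Proof.
move=> cf df x.
have -> : f' x = limn (pseries (pseries_diffs c) x).
  rewrite -(@derive_val _ _ _ _ _ _ _ (df x)).
  exact: (@derive_val _ _ _ _ _ _ _ (is_derive_pseries cf x)).
apply: is_cvg_pseries_diffs => y.
by apply/cvg_ex; exists (f y); exact: cf.
Qed.

Lemma cvg_pseries_at0 c : pseries c 0 @ \oo --> c 0.
Proof.
apply: cvg_near_cst; near=> n; have n0 : (0 < n)%N by near: n; exists 1%N.
rewrite /pseries /series /= -(prednK n0) big_nat_recl//= expr0 mulr1 big1 ?addr0//.
by move=> i _; rewrite expr0n mulr0.
Unshelve. all: by end_near. Qed.

(** The value at 0 gives c_0 = 0. The differentiated series also sums to 0, so the induction
    hypothesis applied to it handles the next coefficient. *)
Lemma pseries_eq0 c : (forall x, pseries c x @ \oo --> (0 : R)) -> forall n, c n = 0.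
Proof.
move=> + n; elim: n c => [|n IH] c c0.
  by rewrite -(cvg_lim _ (@cvg_pseries_at0 c))//; exact: cvg_lim (c0 0).
have : pseries_diffs c n = 0.
  apply: IH; apply: (cvg_pseries_diffs c0) => x; exact: is_derive_cst.
by move=> /eqP; rewrite mulf_eq0 pnatr_eq0 => /eqP.
Qed.

Lemma cvg_pseriesD u v x (k l : R) : pseries u x @ \oo --> k ->
  pseries v x @ \oo --> l -> pseries (u \+ v) x @ \oo --> k + l.
Proof.
move=> uk vl; rewrite (_ : pseries _ _ = pseries u x + pseries v x); first exact: cvgD.
apply/funext => n; rewrite fctE /pseries /series /= -big_split.
by apply: eq_bigr => i _; rewrite mulrDl.
Qed.

Lemma cvg_pseriesZ a u x (k : R) : pseries u x @ \oo --> k ->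
  pseries (fun n => a * u n) x @ \oo --> a * k.
Proof.
move=> uk; rewrite (_ : pseries _ _ = fun n => a * pseries u x n); first exact: cvgMl_tmp.
apply/funext => n; rewrite /pseries /series /= mulr_sumr.
by apply: eq_bigr => i _; rewrite mulrA.
Qed.

Lemma cvg_pseries_shift u x (k : R) : pseries u x @ \oo --> k ->
  pseries (shift u) x @ \oo --> x * k.
Proof.
move=> uk; rewrite -cvg_shiftS.
rewrite (_ : (fun _ => _) = fun n => x * pseries u x n); first exact: cvgMl_tmp.
apply/funext => n; rewrite /pseries /series /= big_nat_recl//= mul0r add0r mulr_sumr.
by apply: eq_bigr => i _; rewrite exprS mulrCA.
Qed.

Lemma pseries_inj u v (f : R -> R) : (forall x, pseries u x @ \oo --> f x) ->
  (forall x, pseries v x @ \oo --> f x) -> u =1 v.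
Proof.
move=> uf vf n; apply/eqP; rewrite -subr_eq0; apply/eqP.
have := @pseries_eq0 (u \+ (fun n => -1 * v n)) _ n.
rewrite /= mulN1r; apply => x.
have -> : 0 = f x + -1 * f x by rewrite mulN1r subrr.
by apply: cvg_pseriesD => //; apply: cvg_pseriesZ.
Qed.

End EntireSeries.

Local Open Scope complex_scope.

(** * From the complex generating series to a recurrence, via real and imaginary parts *)

Section ComplexSeries.
Local Open Scope classical_set_scope.
Variable R : realType.

Lemma complex_archimedean : Num.archimedean_axiom R[i].
Proof.
move=> x; rewrite normc_def; set r := Num.sqrt _.
exists (Num.bound r); rewrite -(rmorph_nat (real_complex R)) /= ltcR archi_boundP//.
exact: sqrtr_ge0.
Qed.

Lemma cvg_complexRe (u : nat -> R[i]) (l : R[i]) :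
  (u : nat -> R[i]^o) @ \oo --> (l : R[i]^o) ->
  (fun n => complex.Re (u n)) @ \oo --> complex.Re l.
Proof.
move=> /cvgrPdist_lt ul; apply/cvgrPdist_lt => e e0.
have := ul e%:C; rewrite ltcR => /(_ e0); apply: filterS => n lun.
have -> : complex.Re l - complex.Re (u n) = complex.Re (l - u n).
  by case: l {lun ul} => a b; case: (u n).
by rewrite -ltcR (le_lt_trans (normc_ge_Re _)).
Qed.

Lemma cvg_complexIm (u : nat -> R[i]) (l : R[i]) :
  (u : nat -> R[i]^o) @ \oo --> (l : R[i]^o) ->
  (fun n => complex.Im (u n)) @ \oo --> complex.Im l.
Proof.
move=> ul.
have Im_Re (z : R[i]) : complex.Im z = complex.Re (- 'i * z) by case: z => a b; simpc.
rewrite Im_Re (_ : (fun _ => _) = fun n => complex.Re (- 'i * u n)); last first.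
  by apply/funext => n; rewrite Im_Re.
apply: (@cvg_complexRe (fun n => - 'i * u n)).
exact: (@cvgMl_tmp _ _ _ _ (u : nat -> R[i]^o)).
Qed.

Lemma complexRe_sum n (F : nat -> R[i]) :
  complex.Re (\sum_(0 <= i < n) F i) = \sum_(0 <= i < n) complex.Re (F i).
Proof. by apply: (big_morph (@complex.Re R)) => // -[a b] [a' b']. Qed.

Lemma complexIm_sum n (F : nat -> R[i]) :
  complex.Im (\sum_(0 <= i < n) F i) = \sum_(0 <= i < n) complex.Im (F i).
Proof. by apply: (big_morph (@complex.Im R)) => // -[a b] [a' b']. Qed.

Lemma cvg_pseries_complex (a : nat -> R[i]) (t : R) (l : R[i]) :
  series (fun m => a m * t%:C ^+ m : R[i]^o) @ \oo --> (l : R[i]^o) ->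
  pseries (fun m => complex.Re (a m)) t @ \oo --> complex.Re l /\
  pseries (fun m => complex.Im (a m)) t @ \oo --> complex.Im l.
Proof.
move=> al; split.
- rewrite (_ : pseries _ _ =
    fun n => complex.Re (series (fun m => a m * t%:C ^+ m) n)).
    exact: cvg_complexRe al.
  apply/funext => n; rewrite /pseries /series /= complexRe_sum; apply: eq_bigr => i _.
  by rewrite -rmorphXn /=; case: (a i) => x y; simpc.
- rewrite (_ : pseries _ _ =
    fun n => complex.Im (series (fun m => a m * t%:C ^+ m) n)).
    exact: cvg_complexIm al.
  apply/funext => n; rewrite /pseries /series /= complexIm_sum; apply: eq_bigr => i _.
  by rewrite -rmorphXn /=; case: (a i) => x y; simpc.
Qed.

(** The real part of F' = (p' + i q') F for F = e^(p + i q); the next lemma is the imaginary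
    part. *)
Lemma is_derive_expR_cos (p q : {poly R}) (t : R) :
  is_derive t (1 : R) (fun t => expR p.[t] * cos q.[t])
    ((deriv p).[t] * (expR p.[t] * cos q.[t]) - (deriv q).[t] * (expR p.[t] * sin q.[t])).
Proof.
have dp := is_derive1_comp (is_derive_expR p.[t]) (is_derive_poly p t).
have dq := is_derive1_comp (is_derive_cos q.[t]) (is_derive_poly q t).
apply: is_derive_eq (is_deriveM dp dq) _.
by rewrite /= /GRing.scale /=; ring.
Qed.

Lemma is_derive_expR_sin (p q : {poly R}) (t : R) :
  is_derive t (1 : R) (fun t => expR p.[t] * sin q.[t])
    ((deriv p).[t] * (expR p.[t] * sin q.[t]) + (deriv q).[t] * (expR p.[t] * cos q.[t])).
Proof.
have dp := is_derive1_comp (is_derive_expR p.[t]) (is_derive_poly p t).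
have dq := is_derive1_comp (is_derive_sin q.[t]) (is_derive_poly q t).
apply: is_derive_eq (is_deriveM dp dq) _.
by rewrite /= /GRing.scale /=; ring.
Qed.

(** Each [shift] contributes a factor t to the sum. *)
Lemma cvg_pseries_exponent_deriv (u : nat -> R) (k al be t l : R) :
  pseries u t @ \oo --> l ->
  pseries (((fun m => k * u m) \+ (fun m => 2 * al * shift u m)) \+
           (fun m => 4 * be * shift (shift (shift u)) m)) t @ \oo -->
  (k + 2 * al * t + 4 * be * t ^+ 3) * l.
Proof.
move=> ul; rewrite (_ : (_ + _) * l =
  k * l + 2 * al * (t * l) + 4 * be * (t * (t * (t * l)))); last by ring.
do 2?apply: cvg_pseriesD; apply: cvg_pseriesZ => //.
  exact: cvg_pseries_shift.
by do 3!apply: cvg_pseries_shift.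
Qed.

(* Restricted to real z, the sum F of the series satisfies
   F' = (c s + 2 alpha z + 4 beta z^3) F; the recurrence compares coefficients. *)
Lemma generated_by_exp_rec (alpha beta c : R) (P : nat -> {poly R[i]}) (s : R[i]) :
  generated_by_exp alpha beta c P ->
  let a m := (P m).[s] / m`!%:R in
  a 0 = 1 /\
  forall m, m.+1%:R * a m.+1 = c%:C * s * a m + 2 * alpha%:C * shift a m +
    4 * beta%:C * shift (shift (shift a)) m.
Proof.
move=> genP a; pose x := complex.Re s; pose y := complex.Im s.
pose u m := complex.Re (a m); pose v m := complex.Im (a m).
(* For real z = t the exponent is p(t) + i q(t); as alpha, beta and c are real, only s contributes
   to q. *)
pose p : {poly R} := (c * x) *: 'X + alpha *: 'X^2 + beta *: 'X^4.
pose q : {poly R} := (c * y) *: 'X.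
have p'E t : (deriv p).[t] = c * x + 2 * alpha * t + 4 * beta * t ^+ 3.
  by rewrite /p !poly.derivE !hornerE /=; ring.
have q'E t : (deriv q).[t] = c * y by rewrite /q !poly.derivE !hornerE.
have uv t : pseries u t @ \oo --> expR p.[t] * cos q.[t] /\
            pseries v t @ \oo --> expR p.[t] * sin q.[t].
  have := cvg_pseries_complex (genP s t%:C).
  have -> : c%:C * t%:C * s + alpha%:C * t%:C ^+ 2 + beta%:C * t%:C ^+ 4 =
      p.[t] +i* q.[t].
    rewrite -!rmorphXn -!rmorphM /p /q !hornerE /= /x /y; case: (s) => x' y' /=.
    by simpc; congr (_ +i* _); ring.
  by rewrite /expC; simpc.
(* Both coefficient sequences have the real part of F' as their sum, so they agree. *)
have uE : pseries_diffs u =1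
    (((fun m => c * x * u m) \+ (fun m => 2 * alpha * shift u m)) \+
     (fun m => 4 * beta * shift (shift (shift u)) m)) \+ (fun m => - (c * y) * v m).
  apply: (@pseries_inj _ _ _ (fun t => (deriv p).[t] * (expR p.[t] * cos q.[t]) -
      (deriv q).[t] * (expR p.[t] * sin q.[t]))).
    apply: (cvg_pseries_diffs (fun t => (uv t).1)) => t.
    exact: is_derive_expR_cos.
  move=> t; rewrite p'E q'E -[- (c * y * _)]mulNr; have [ut vt] := uv t.
  by apply: cvg_pseriesD; [exact: cvg_pseries_exponent_deriv | exact: cvg_pseriesZ].
have vE : pseries_diffs v =1
    (((fun m => c * x * v m) \+ (fun m => 2 * alpha * shift v m)) \+
     (fun m => 4 * beta * shift (shift (shift v)) m)) \+ (fun m => c * y * u m).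
  apply: (@pseries_inj _ _ _ (fun t => (deriv p).[t] * (expR p.[t] * sin q.[t]) +
      (deriv q).[t] * (expR p.[t] * cos q.[t]))).
    apply: (cvg_pseries_diffs (fun t => (uv t).2)) => t.
    exact: is_derive_expR_sin.
  move=> t; rewrite p'E q'E; have [ut vt] := uv t.
  by apply: cvg_pseriesD; [exact: cvg_pseries_exponent_deriv | exact: cvg_pseriesZ].
have aE m : a m = u m +i* v m by rewrite /u /v; case: (a m).
have saE (d : nat -> R[i]) (d1 d2 : nat -> R) m :
  (forall k, d k = d1 k +i* d2 k) -> shift d m = shift d1 m +i* shift d2 m.
  by move=> dE; case: m => [|m] /=.
split.
  (* At t = 0 the series reduces to its constant term and the exponential to 1. *)
  rewrite aE; have [] := uv 0.
  rewrite /p /q !hornerE /= ?mulr0 !addr0 expR0 cos0 sin0 !mulr1 mulr0.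
  move=> /(cvg_lim _) u0 /(cvg_lim _) v0.
  have u0' := cvg_lim _ (@cvg_pseries_at0 _ u).
  have v0' := cvg_lim _ (@cvg_pseries_at0 _ v).
  by rewrite -u0' // u0 // -v0' // v0.
move=> m; have sE : s = x +i* y by rewrite /x /y; case: (s).
rewrite (saE _ _ _ m (fun k => saE _ _ _ k (fun j => saE _ _ _ j aE))).
rewrite (saE _ _ _ m aE) !aE sE.
have := uE m; have := vE m; rewrite /pseries_diffs /=.
rewrite -(rmorph_nat (real_complex R)) -(rmorph_nat (real_complex R) 2).
rewrite -(rmorph_nat (real_complex R) 4) -!rmorphM /=; simpc => -> ->.
by congr (_ +i* _); ring.
Qed.

End ComplexSeries.

(** * Location of the zeros *)

Theorem theorem1 (R : realType) (alpha beta c : R) (P : nat -> {poly R[i]}) :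
  beta < 0 -> c != 0 ->
  generated_by_exp alpha beta c P ->
  forall (m : nat) (s : R[i]), root (P m) s -> complex.Im s = 0 \/ complex.Re s = 0.
Proof.
move=> beta0 c0 genP m s /eqP Ps.
have [a0 aS] := generated_by_exp_rec s genP.
have := exp_quartic_coef_zero (@complex_archimedean R) (m := m) _ _ a0 aS.
rewrite Ps mul0r => /(_ _ _ erefl) cs.
have {cs} : (c%:C * s) ^+ 2 \is Num.real.
  by apply: cs; rewrite ?complex_real ?ltcR.
(* With s = x + i y, the imaginary part of (c s)^2 is 2 c^2 x y, and c is nonzero. *)
move=> /Creal_ImP; rewrite -complexIm expr2; case: s {Ps a0 aS} => x y; simpc.
move=> /= [] h; have {h} /eqP : c ^+ 2 * 2 * (x * y) = 0 by rewrite -h; ring.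
rewrite !mulf_eq0 (negPf c0) pnatr_eq0 /=.
by move=> /orP[] /eqP ->; [right|left].
Qed.
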